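(* Let $\Omega\subset\mathbb{R}^n$, let $\mathcal{A}\subset \mathcal{P}(\Omega)$ be an algebra and let $\lambda\in \mathrm{ba}(\Omega,\mathcal{A})$. Then for every $\mu\in \mathrm{ba}(\Omega,\mathcal{A},\lambda)$ there exist unique $\mu_c\in \mathrm{ca}(\Omega,\mathcal{A})\cap \mathrm{ba}(\Omega,\mathcal{A},\lambda)$ and $\mu_p\in \mathrm{ca}(\Omega,\mathcal{A})^\perp\cap \mathrm{ba}(\Omega,\mathcal{A},\lambda)$ such that $$\mu = \mu_c+\mu_p .$$
   Context: An algebra $\mathcal{A}\subset\mathcal{P}(\Omega)$ is a class of subsets of $\Omega$ stable under (finite) unions, intersections and differences and containing $\emptyset$. A measure on $\mathcal{A}$ is a finitely additive function $\mu:\mathcal{A}\to\mathbb{R}$; it is a $\sigma$-measure if it is countably additive (on pairwise disjoint sequences in $\mathcal A$ whose union lies in $\mathcal{A}$). It is bounded if $\sup_{A\in\mathcal{A}}|\mu(A)|<\infty$. $\mathrm{ba}(\Omega,\mathcal{A})$ is the set of all bounded measures and $\mathrm{ca}(\Omega,\mathcal{A})$ the set of all bounded $\sigma$-measures on $\mathcal{A}$. $\mathrm{ba}(\Omega,\mathcal{A})$ is a vector lattice with the order $\mu\leq\nu$ iff $\mu(A)\leq\nu(A)$ for all $A\in\mathcal{A}$. Its total variation is $|\mu| = (\mu\vee 0) + ((-\mu)\vee 0)$, i.e. $|\mu|(A) = \sup\sum_{k}|\mu(A_k)|$ over finite partitions of $A$ into sets of $\mathcal{A}$, and $(\mu\wedge\nu)(A)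 = \inf\{\mu(A')+\nu(A\setminus A') : A'\in\mathcal{A}, A'\subset A\}$. Two elements are orthogonal if $|\mu|\wedge|\nu|=0$, and $\mathrm{ca}(\Omega,\mathcal{A})^\perp$ is the set of $\mu\in\mathrm{ba}(\Omega,\mathcal{A})$ orthogonal to all elements of $\mathrm{ca}(\Omega,\mathcal{A})$ (such measures are called pure). $\mu\in\mathrm{ba}(\Omega,\mathcal{A})$ is weakly absolutely continuous with respect to $\lambda$ if for every $A\in\mathcal{A}$, $|\lambda|(A)=0$ implies $\mu(A)=0$. $\mathrm{ba}(\Omega,\mathcal{A},\lambda)$ denotes the set of all $\mu\in\mathrm{ba}(\Omega,\mathcal{A})$ that are weakly absolutely continuous with respect to $\lambda$. *)

(* Defs.v *)
From HB Require Import structures.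
From mathcomp Require Import all_boot all_order all_algebra.
From mathcomp Require Import all_classical all_reals all_analysis.

Set Implicit Arguments.
Unset Strict Implicit.
Unset Printing Implicit Defensive.

Import Order.TTheory GRing.Theory Num.Theory.
Import numFieldNormedType.Exports.

Local Open Scope classical_set_scope.
Local Open Scope ring_scope.

(* Omega itself need not belong to an algebra. *)
Definition set_algebra (T : Type) (Omega : set T) (A : set (set T)) : Prop :=
  [/\ A `<=` [set X | X `<=` Omega], A set0,
      setU_closed A, setI_closed A & setD_closed A].

Section Measures.
Variables (R : realType) (T : Type) (A : set (set T)).

(* A set function on A is a function on the subtype of the members of A, so
   that equality of measures is equality on A only.  The members of A arising
   from unions and differences are characterised by their underlying sets. *)
Implicit Types (mu nu lambda : A -> R) (X Y Z : A).

Definition finitely_additive mu : Prop :=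
  forall X Y Z, \val X `&` \val Y = set0 -> \val Z = \val X `|` \val Y ->
    mu Z = mu X + mu Y.

Definition countably_additive mu : Prop :=
  forall (F : nat -> A) Z,
    trivIset setT (fun k => \val (F k)) -> \val Z = \bigcup_k \val (F k) ->
    series (mu \o F) @ \oo --> mu Z.

Definition bounded_measure mu : Prop :=
  has_ubound (range (fun X => `|mu X|)).

Definition ba : set (A -> R) :=
  [set mu | finitely_additive mu /\ bounded_measure mu].

Definition ca : set (A -> R) := [set mu | ba mu /\ countably_additive mu].

(* Used on [ba] only: there the set of sums is bounded, as needed for the
   real-valued [sup]. *)
Definition measure_variation mu : A -> R := fun Z =>
  sup [set s | exists (m : nat) (P : 'I_m -> A),
    [/\ trivIset setT (fun k => \val (P k)),
        \bigcup_k \val (P k) = \val Z &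
        s = \sum_(k < m) `|mu (P k)|]].

Definition measure_meet mu nu : A -> R := fun Z =>
  inf [set s | exists X Y,
    [/\ \val X `<=` \val Z, \val Y = \val Z `\` \val X & s = mu X + nu Y]].

Definition orthogonal_measures mu nu : Prop :=
  measure_meet (measure_variation mu) (measure_variation nu) = cst 0.

Definition ca_orth : set (A -> R) :=
  [set mu | ba mu /\ forall nu, ca nu -> orthogonal_measures mu nu].

Definition weakly_abs_continuous mu lambda : Prop :=
  forall X, measure_variation lambda X = 0 -> mu X = 0.

Definition ba_wac lambda : set (A -> R) :=
  [set mu | ba mu /\ weakly_abs_continuous mu lambda].

End Measures.

Arguments ba {R T} A.
Arguments ca {R T} A.
Arguments ca_orth {R T} A.
Arguments ba_wac {R T} A lambda.

(* Main.v *)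
(** For [mu >= 0] let [mu_c] be the supremum of all [nu] in [ca] with
    [nu <= mu].  Since [ca] is closed under binary suprema, this family is
    directed, so [mu_c] is additive; countable additivity passes to the
    supremum, so [mu_c] is the largest element of [ca] below [mu].  For
    [nu] in [ca] the meet [rho] of [mu - mu_c] and [|nu|] is dominated by
    [|nu|], hence lies in [ca], and [mu_c + rho <= mu] forces [rho = 0].  A
    signed [mu] is split as [mu^+ - mu^-]; both parts, and everything they
    dominate, inherit weak absolute continuity.  For uniqueness, the difference
    of two decompositions lies in [ca] and is orthogonal to itself. *)
Require Import Defs.
From HB Require Import structures.
From mathcomp Require Import all_boot all_order all_algebra.
From mathcomp Require Import all_classical all_reals all_analysis.
From mathcomp Require Import ring lra.

Set Implicit Arguments.
Unset Strict Implicit.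
Unset Printing Implicit Defensive.

Import Order.TTheory GRing.Theory Num.Theory.
Import numFieldNormedType.Exports.

Local Open Scope classical_set_scope.
Local Open Scope ring_scope.

(** * Set operations inside the algebra and finite additivity *)

Section BoundedMeasures.
Variables (R : realType) (T : Type) (Omega : set T) (A : set (set T)).
Hypothesis hA : set_algebra Omega A.
Implicit Types (mu nu rho : A -> R) (X Y Z : A).

Definition member {X : set T} (AX : A X) : A := SigSub (mem_set AX).

Lemma memberP X : A (\val X).
Proof. exact: set_mem (valP X). Qed.

Lemma alg0_subproof : A set0. Proof. by case: hA. Qed.
Lemma algU_subproof X Y : A (\val X `|` \val Y).
Proof. by case: hA => _ _ + _ _; apply; exact: memberP. Qed.
Lemma algI_subproof X Y : A (\val X `&` \val Y).
Proof. by case: hA => _ _ _ + _; apply; exact: memberP. Qed.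
Lemma algD_subproof X Y : A (\val X `\` \val Y).
Proof. by case: hA => _ _ _ _; apply; exact: memberP. Qed.

Definition alg0 : A := member alg0_subproof.
Definition algU X Y : A := member (algU_subproof X Y).
Definition algI X Y : A := member (algI_subproof X Y).
Definition algD X Y : A := member (algD_subproof X Y).

Fixpoint alg_bigU (F : nat -> A) (n : nat) : A :=
  if n is n'.+1 then algU (alg_bigU F n') (F n') else alg0.

Lemma alg_bigUE F n : \val (alg_bigU F n) = \bigcup_(k < n) \val (F k).
Proof.
elim: n => [|n IHn]; first by rewrite bigcup_mkord big_ord0.
by rewrite bigcup_mkord big_ord_recr -(bigcup_mkord n (fun k => \val (F k))) -IHn.
Qed.

Section FinitelyAdditive.
Variable mu : A -> R.
Hypothesis hmu : finitely_additive mu.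

Lemma fin_add0 : mu alg0 = 0.
Proof.
have /= := @hmu alg0 alg0 alg0; rewrite setI0 setU0 => /(_ erefl erefl).
lra.
Qed.

Lemma fin_add_subset Y Z : \val Y `<=` \val Z -> mu Z = mu Y + mu (algD Z Y).
Proof.
move=> YZ; apply: hmu => /=; first by rewrite setDIK.
by rewrite setDUK.
Qed.

Lemma fin_add_setID X Y : mu X = mu (algI X Y) + mu (algD X Y).
Proof.
apply: hmu => /=; last by rewrite setUIDK.
by rewrite -setIA setDIK setI0.
Qed.

Lemma fin_add_bigU (F : nat -> A) n : trivIset setT (fun k => \val (F k)) ->
  mu (alg_bigU F n) = \sum_(k < n) mu (F k).
Proof.
move=> tF; elim: n => [|n IHn]; first by rewrite big_ord0 fin_add0.
rewrite big_ord_recr -IHn; apply: hmu => //=.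
rewrite alg_bigUE; apply/seteqP; split=> // x [[k /= kn Fkx] Fnx].
have kE : k = n by apply: tF => //; exists x.
by rewrite kE ltnn in kn.
Qed.

Lemma fin_add_partition m (P : 'I_m -> A) Z :
  trivIset setT (fun k => \val (P k)) -> \bigcup_k \val (P k) = \val Z ->
  mu Z = \sum_(k < m) mu (P k).
Proof.
(* The finite family is padded with the empty set to a disjoint sequence, so that [fin_add_bigU]
   applies. *)
move=> tP PZ; pose F k := oapp P alg0 (insub k : option 'I_m).
have FE (k : 'I_m) : F k = P k by rewrite /F valK.
have tF : trivIset setT (fun k => \val (F k)).
  move=> i j _ _; rewrite /F.
  case: insubP => [i' _ <-|_ [x []//]]; case: insubP => [j' _ <-|_ [x []//]].
  by move=> /= /(tP i' j' I I) ->.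
under eq_bigr do rewrite -FE.
rewrite -fin_add_bigU //; congr mu; apply: val_inj.
rewrite alg_bigUE -PZ; apply/seteqP; split=> x.
  by move=> [k _ Pkx]; exists (val k) => /=; [exact: ltn_ord|rewrite FE].
by move=> [k /= km]; have := FE (Ordinal km) => /= ->; exists (Ordinal km).
Qed.

End FinitelyAdditive.

Lemma fin_add_le mu Y Z : finitely_additive mu -> (forall X, 0 <= mu X) ->
  \val Y `<=` \val Z -> mu Y <= mu Z.
Proof. by move=> hmu mu0 /(fin_add_subset hmu) ->; rewrite lerDl. Qed.

Lemma fin_addD mu nu : finitely_additive mu -> finitely_additive nu ->
  finitely_additive (mu \+ nu).
Proof. by move=> hmu hnu X Y Z XY ZE /=; rewrite (hmu X Y) // (hnu X Y) //; ring. Qed.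

Lemma fin_addN mu : finitely_additive mu -> finitely_additive (\- mu).
Proof. by move=> hmu X Y Z XY ZE /=; rewrite (hmu X Y) //; ring. Qed.

(** * Linear structure of bounded measures and bounded sigma-measures *)

Lemma bounded_measureP mu :
  bounded_measure mu <-> exists M, forall X, `|mu X| <= M.
Proof.
split=> -[M hM]; exists M; first by move=> X; apply: hM; exists X.
by move=> _ [X _ <-].
Qed.

Lemma baD mu nu : ba A mu -> ba A nu -> ba A (mu \+ nu).
Proof.
move=> [fmu /bounded_measureP[M hM]] [fnu /bounded_measureP[N hN]].
split; first exact: fin_addD.
apply/bounded_measureP; exists (M + N) => X.
by rewrite (le_trans (ler_normD _ _))// lerD.
Qed.

Lemma baN mu : ba A mu -> ba A (\- mu).
Proof.
move=> [fmu /bounded_measureP[M hM]]; split; first exact: fin_addN.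
by apply/bounded_measureP; exists M => X; rewrite normrN.
Qed.

Lemma baB mu nu : ba A mu -> ba A nu -> ba A (mu \- nu).
Proof. by move=> hmu hnu; apply: baD => //; exact: baN. Qed.

Lemma ba_dominated mu nu : finitely_additive mu -> ba A nu ->
  (forall X, 0 <= mu X <= nu X) -> ba A mu.
Proof.
move=> fmu [fnu /bounded_measureP[M hM]] munu; split=> //.
apply/bounded_measureP; exists M => X; have /andP[mu0 le_mu] := munu X.
by rewrite ger0_norm// (le_trans le_mu)// (le_trans (ler_norm _)).
Qed.

Lemma caD mu nu : ca A mu -> ca A nu -> ca A (mu \+ nu).
Proof.
move=> [bmu cmu] [bnu cnu]; split; first exact: baD.
move=> F Z tF ZF; rewrite (_ : series _ = series (mu \o F) \+ series (nu \o F)).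
  by apply: cvgD; [exact: cmu|exact: cnu].
by apply/funext => n; rewrite /= /series/= big_split.
Qed.

Lemma caN mu : ca A mu -> ca A (\- mu).
Proof.
move=> [bmu cmu]; split; first exact: baN.
move=> F Z tF ZF; rewrite (_ : series _ = \- series (mu \o F)).
  by apply: cvgN; exact: cmu.
by apply/funext => n; rewrite /= /series/= sumrN.
Qed.

Lemma caB mu nu : ca A mu -> ca A nu -> ca A (mu \- nu).
Proof. by move=> hmu hnu; apply: caD => //; exact: caN. Qed.

Lemma ca0 : ca A (cst 0 : A -> R).
Proof.
split; first split.
- by move=> X Y Z _ _ /=; rewrite addr0.
- by apply/bounded_measureP; exists 0 => X; rewrite normr0.
move=> F Z _ _; rewrite (_ : series _ = cst 0); first exact: cvg_cst.
by apply/funext => n; rewrite /series/= big1.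
Qed.

(** * Criteria for countable additivity *)

Lemma series_remainder (F : nat -> A) Z mu n : finitely_additive mu ->
  trivIset setT (fun k => \val (F k)) -> \val Z = \bigcup_k \val (F k) ->
  mu Z = series (mu \o F) n + mu (algD Z (alg_bigU F n)).
Proof.
move=> fmu tF ZF; rewrite [LHS](fin_add_subset fmu (Y := alg_bigU F n)).
  by rewrite fin_add_bigU// /series/= big_mkord.
by rewrite alg_bigUE ZF => x [k _ Fkx]; exists k.
Qed.

(** The remainder of [mu] after [n] terms lies between 0 and that of [nu], which tends to 0. *)
Lemma ca_dominated mu nu : finitely_additive mu -> ca A nu ->
  (forall X, 0 <= mu X <= nu X) -> ca A mu.
Proof.
move=> fmu [bnu cnu] munu; split; first exact: ba_dominated bnu munu.
move=> F Z tF ZF; have rem := fun m n fm => @series_remainder F Z m n fm tF ZF.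
apply: (squeeze_cvgr (f := fun n => mu Z - (nu Z - series (nu \o F) n))
  (h := fun=> mu Z)); last exact: cvg_cst.
  apply: nearW => n; rewrite (rem mu n)// (rem nu n)//; last by case: bnu.
  by have := munu (algD Z (alg_bigU F n)); lra.
rewrite -[X in _ --> X]subr0 -(subrr (nu Z)).
by apply: cvgB; [exact: cvg_cst|apply: cvgB; [exact: cvg_cst|exact: cnu]].
Qed.

(* Countable subadditivity is stated through an upper bound [b] of the partial
   sums so that it can be checked on each member of a family whose supremum is
   [m]. *)
Lemma ca_nonneg (m : A -> R) : ba A m -> (forall X, 0 <= m X) ->
  (forall (F : nat -> A) Z b, trivIset setT (fun k => \val (F k)) ->
    \val Z = \bigcup_k \val (F k) ->
    (forall n, series (m \o F) n <= b) -> m Z <= b) ->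
  ca A m.
Proof.
move=> bm m0 msub; split=> // F Z tF ZF; have [fm _] := bm.
have ubZ n : series (m \o F) n <= m Z.
  by rewrite (series_remainder n fm tF ZF) lerDl.
have hub : has_ubound (range (series (m \o F))).
  by exists (m Z) => _ [n _ <-].
(* The partial sums increase to their supremum; [ubZ], together with [msub] applied with this
   supremum as [b], identifies it with [m Z]. *)
rewrite (_ : m Z = sup (range (series (m \o F)))).
  apply: nondecreasing_cvgn => //; apply/nondecreasing_seqP => n.
  by rewrite /series/= big_nat_recr//= lerDl.
apply/eqP; rewrite eq_le; apply/andP; split.
  by apply: (msub F) => // n; apply: ub_le_sup => //; exists n.
apply: ge_sup => [|_ [n _ <-]]; last exact: ubZ.
by exists (series (m \o F) 0%N); exists 0%N.
Qed.

(** Serves to check the bound required by [ca_nonneg] for set functions that are suprema: [nu Z] is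
    a limit of partial sums dominated by those of [m]. *)
Lemma ca_le_series nu (m : nat -> R) (F : nat -> A) Z b : ca A nu ->
  trivIset setT (fun k => \val (F k)) -> \val Z = \bigcup_k \val (F k) ->
  (forall k, nu (F k) <= m k) -> (forall n, series m n <= b) -> nu Z <= b.
Proof.
move=> [_ cnu] tF ZF num mb; apply: (cvgr_to_le (cnu F Z tF ZF)).
by apply: nearW => n; apply: le_trans (mb n); apply: ler_sum => k _; exact: num.
Qed.


(** * The positive part of a bounded measure, its join with 0 *)

Definition measure_pos nu : A -> R := fun Z =>
  sup [set nu Y | Y in [set Y : A | \val Y `<=` \val Z]].

Section PositivePart.
Variable nu : A -> R.
Hypothesis hnu : ba A nu.

Lemma measure_pos_ub Y Z : \val Y `<=` \val Z -> nu Y <= measure_pos nu Z.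
Proof.
move=> YZ; apply: ub_le_sup; last by exists Y.
have [_ /bounded_measureP[M hM]] := hnu.
by exists M => _ [X _ <-]; exact: le_trans (ler_norm _) (hM X).
Qed.

Lemma measure_pos_le Z c :
  (forall Y, \val Y `<=` \val Z -> nu Y <= c) -> measure_pos nu Z <= c.
Proof.
move=> hc; apply: ge_sup => [|_ [Y YZ <-]]; last exact: hc.
by exists (nu Z); exists Z.
Qed.

Lemma measure_pos_ge Z : nu Z <= measure_pos nu Z.
Proof. exact: measure_pos_ub. Qed.

Lemma measure_pos_ge0 Z : 0 <= measure_pos nu Z.
Proof.
by rewrite -(fin_add0 (proj1 hnu)); apply: measure_pos_ub => x [].
Qed.

(** A subset of [Z] splits along [X] into a subset of [X] and one of [Y]; conversely, subsets of [X]
    and of [Y] have a disjoint union inside [Z]. Each fact gives one inequality. *)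
Lemma fin_add_measure_pos : finitely_additive (measure_pos nu).
Proof.
have [fnu _] := hnu.
move=> X Y Z XY0 ZE; apply/eqP; rewrite eq_le; apply/andP; split.
  apply: measure_pos_le => W WZ.
  rewrite (fin_add_setID fnu W X) lerD//; apply: measure_pos_ub => /=.
    exact: subIsetr.
  by move=> x [/WZ]; rewrite ZE => -[].
rewrite -lerBrDr; apply: measure_pos_le => X' X'X.
rewrite lerBrDr -lerBrDl; apply: measure_pos_le => Y' Y'Y.
rewrite lerBrDl -(fnu X' Y' (algU X' Y'))//.
  by apply: measure_pos_ub; rewrite ZE; exact: setUSS.
by rewrite -subset0 -XY0; exact: setISS.
Qed.

Lemma ba_measure_pos : ba A (measure_pos nu).
Proof.
split; first exact: fin_add_measure_pos.
have [_ /bounded_measureP[M hM]] := hnu.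
apply/bounded_measureP; exists M => Z; rewrite ger0_norm ?measure_pos_ge0//.
by apply: measure_pos_le => Y _; exact: le_trans (ler_norm _) (hM Y).
Qed.

End PositivePart.

Lemma ca_measure_pos nu : ca A nu -> ca A (measure_pos nu).
Proof.
move=> cnu; have [bnu _] := cnu.
apply: ca_nonneg; [exact: ba_measure_pos|exact: measure_pos_ge0|].
move=> F Z b tF ZF hb; apply: measure_pos_le => Y YZ.
(* The subset [Y] of [Z] is cut along the [F k]; on each piece [nu] is at most its positive part at
   [F k]. *)
apply: (ca_le_series (F := fun k => algI Y (F k)) cnu _ _ _ hb).
- exact: trivIset_setIl tF.
- by rewrite /= -setI_bigcupr -ZF; apply/esym/setIidPl.
- by move=> k; apply: measure_pos_ub => // x [].
Qed.

(** * Total variation *)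

(** The right-hand side is nu^+ + nu^-, since nu^- = nu^+ - nu. It turns the supremum over
    partitions into one over subsets, so that the variation inherits its properties from
    [measure_pos]. *)
Lemma measure_variationE nu Z : ba A nu ->
  measure_variation nu Z = 2 * measure_pos nu Z - nu Z.
Proof.
move=> bnu; have [fnu _] := bnu.
pose v := measure_pos nu \+ (measure_pos nu \- nu).
have fv : finitely_additive v.
  by case: (baD (ba_measure_pos bnu) (baB (ba_measure_pos bnu) bnu)).
have le_v X : `|nu X| <= v X.
  rewrite /v/= ler_norml; have := measure_pos_ge bnu X.
  by have := measure_pos_ge0 bnu X; lra.
have vE : 2 * measure_pos nu Z - nu Z = v Z by rewrite /v/=; ring.
rewrite vE /measure_variation; set E := [set s | _].
(* The set function [v] is additive and dominates |nu|, hence bounds every partition sum. *)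
have ubE : ubound E (v Z).
  move=> _ [m [P [tP PZ ->]]]; rewrite (fin_add_partition fv tP PZ).
  exact: ler_sum.
apply/eqP; rewrite eq_le; apply/andP; split.
  apply: ge_sup ubE; exists `|nu Z|, 1%N, (fun=> Z); split.
  - by move=> i j _ _ _; rewrite !ord1.
  - by apply/seteqP; split=> [x [_ _]//|x Zx]; exists ord0.
  - by rewrite big_ord1.
rewrite -vE; have supE : has_ubound E by exists (v Z).
(* For [Y] inside [Z], 2 nu(Y) - nu(Z) = nu(Y) - nu(Z \ Y), which is at most the sum over the
   partition of [Z] into [Y] and Z \ Y. *)
rewrite lerBlDr -ler_pdivlMl//; apply: measure_pos_le => Y YZ.
rewrite ler_pdivlMl// -lerBlDr (fin_add_subset fnu YZ).
apply: (@le_trans _ _ (`|nu Y| + `|nu (algD Z Y)|)).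
  have := ler_norm (nu Y); have := ler_norm (- nu (algD Z Y)).
  by rewrite normrN; lra.
apply: ub_le_sup => //.
exists 2%N, (fun i : 'I_2 => if i == ord0 then Y else algD Z Y); split.
- apply/trivIsetP => -[[|[|//]] ?] [[|[|//]] ?] _ _ //= _; first exact: setDIK.
  by rewrite setIC setDIK.
- apply/seteqP; split=> x.
    by move=> [i _]; case: ifP => _ => [/YZ//|[]].
  move=> Zx; have [Yx|nYx] := pselect (\val Y x); first by exists ord0.
  by exists ord_max.
- by rewrite big_ord_recl big_ord1.
Qed.

Lemma measure_variation_eq nu : ba A nu ->
  measure_variation nu = measure_pos nu \+ (measure_pos nu \- nu).
Proof. by move=> bnu; apply/funext => Z; rewrite measure_variationE//=; ring. Qed.

Lemma ba_variation nu : ba A nu -> ba A (measure_variation nu).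
Proof.
move=> bnu; rewrite measure_variation_eq//.
have bp := ba_measure_pos bnu; exact: baD bp (baB bp bnu).
Qed.

Lemma ca_variation nu : ca A nu -> ca A (measure_variation nu).
Proof.
move=> cnu; have [bnu _] := cnu; rewrite measure_variation_eq//.
by apply: caD; [|apply: caB => //]; exact: ca_measure_pos.
Qed.

Lemma norm_le_variation nu X : ba A nu -> `|nu X| <= measure_variation nu X.
Proof.
move=> bnu; rewrite measure_variationE// ler_norml.
by have := measure_pos_ge bnu X; have := measure_pos_ge0 bnu X; lra.
Qed.

Lemma variation_ge0 nu X : ba A nu -> 0 <= measure_variation nu X.
Proof. by move=> bnu; apply: le_trans (norm_le_variation X bnu). Qed.

(** For [Y] inside [X], 2 nu(Y) - nu(X) = nu(Y) - nu(X \ Y) <= v(Y) + v(X \ Y) = v(X). Thus the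
    variation is the least additive majorant of |nu|. *)
Lemma variation_le nu (v : A -> R) X : ba A nu -> finitely_additive v ->
  (forall Y, `|nu Y| <= v Y) -> measure_variation nu X <= v X.
Proof.
move=> bnu fv nuv; rewrite measure_variationE// lerBlDr -ler_pdivlMl//.
apply: measure_pos_le => Y YX; rewrite ler_pdivlMl//.
rewrite (fin_add_subset (proj1 bnu) YX) (fin_add_subset fv YX).
have := nuv Y; have := nuv (algD X Y); rewrite !ler_norml; lra.
Qed.

(** * Orthogonality through approximate separation *)

(** Used to merge two separating sets [Y1] and [Y2] into one: the complement of their intersection
    is the union of their complements. *)
Lemma fin_add_setDI_le (b : A -> R) X Y1 Y2 : finitely_additive b ->
  (forall Y, 0 <= b Y) ->
  b (algD X (algI Y1 Y2)) <= b (algD X Y1) + b (algD X Y2).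
Proof.
move=> fb b0; rewrite (fin_add_setID fb _ (algD X Y1)) lerD//.
  by apply: fin_add_le => //; exact: subIsetr.
apply: fin_add_le => // x /= [[Xx nYx] nXYx]; split=> // Y2x.
by apply: nXYx; split=> // Y1x; exact: nYx.
Qed.

(** An infimum of sums of two nonnegative terms is 0 exactly when both terms can be made small at
    once. Later arguments handle these separating sets in place of the meet. *)
Lemma orthogonal_measuresP mu nu : ba A mu -> ba A nu ->
  orthogonal_measures mu nu <->
  forall X e, 0 < e -> exists Y, [/\ \val Y `<=` \val X,
    measure_variation mu Y <= e & measure_variation nu (algD X Y) <= e].
Proof.
move=> bmu bnu; rewrite /orthogonal_measures /measure_meet; split.
  move=> meet0 X e e0; have {}meet0 := congr1 (fun f : A -> R => f X) meet0.
  move: meet0 => /=; set E := [set s | _] => E0.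
  have [|s [Y [Y' [YX Y'E ->]]]] := @inf_adherent _ E e e0.
    split; first by eexists; exists X, (algD X X); split.
    by exists 0 => _ [Y [Y' [_ _ ->]]]; rewrite addr_ge0// variation_ge0.
  rewrite E0 add0r (_ : Y' = algD X Y); last exact: val_inj.
  have := variation_ge0 Y bmu; have := variation_ge0 (algD X Y) bnu.
  by move=> ? ? ?; exists Y; split=> //; lra.
move=> small; apply/funext => X /=; set E := [set s | _].
have lbE : lbound E 0.
  by move=> _ [Y [Y' [_ _ ->]]]; rewrite addr_ge0// variation_ge0.
apply/eqP; rewrite eq_le; apply/andP; split; last first.
  by apply: lb_le_inf lbE; eexists; exists X, (algD X X); split.
apply/ler_addgt0Pr => e e0; rewrite add0r.
have [|Y [YX muY nuY]] := small X (e / 2); first by rewrite divr_gt0.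
apply: (@le_trans _ _ (measure_variation mu Y + measure_variation nu (algD X Y))).
  by apply: ge_inf; [exists 0|exists Y, (algD X Y); split].
by lra.
Qed.

(** * The countably additive part of a nonnegative measure *)

(** The supremum is taken separately at each [Z], so additivity is not automatic. For [mu >= 0] the
    family contains 0 and its values at [Z] are bounded by [mu Z]. *)
Definition ca_part mu : A -> R := fun Z =>
  sup [set nu Z | nu in [set nu | ca A nu /\ forall X, nu X <= mu X]].

Section CaPart.
Variable mu : A -> R.
Hypotheses (bmu : ba A mu) (mu0 : forall X, 0 <= mu X).

Lemma ca_part_ub nu Z : ca A nu -> (forall X, nu X <= mu X) ->
  nu Z <= ca_part mu Z.
Proof.
move=> cnu numu; apply: ub_le_sup; last by exists nu.
by exists (mu Z) => _ [? [_ h] <-].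
Qed.

Lemma ca_part_le Z c :
  (forall nu, ca A nu -> (forall X, nu X <= mu X) -> nu Z <= c) ->
  ca_part mu Z <= c.
Proof.
move=> hc; apply: ge_sup => [|_ [nu [cnu numu] <-]]; last exact: hc.
by exists 0; exists (cst 0); split=> //; exact: ca0.
Qed.

Lemma ca_part_le_measure Z : ca_part mu Z <= mu Z.
Proof. exact: ca_part_le. Qed.

Lemma ca_part_ge0 Z : 0 <= ca_part mu Z.
Proof. by apply: (@ca_part_ub (cst 0)) => //; exact: ca0. Qed.

(* The measures below [mu] in [ca] are directed: [nu2 + (nu1 - nu2)^+] is the
   supremum of [nu1] and [nu2]. *)
Lemma fin_add_ca_part : finitely_additive (ca_part mu).
Proof.
move=> X Y Z XY0 ZE; apply/eqP; rewrite eq_le; apply/andP; split.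
  apply: ca_part_le => nu cnu numu; rewrite (cnu.1.1 X Y Z)//.
  by rewrite lerD// ca_part_ub.
rewrite -lerBrDr; apply: ca_part_le => nu1 cnu1 nu1mu.
rewrite lerBrDr -lerBrDl; apply: ca_part_le => nu2 cnu2 nu2mu; rewrite lerBrDl.
have c12 := caB cnu1 cnu2; have [b12 _] := c12.
pose w := nu2 \+ measure_pos (nu1 \- nu2).
have cw : ca A w by apply: caD => //; exact: ca_measure_pos.
have wmu W : w W <= mu W.
  (* For [V] inside [W], (nu1 - nu2)(V) <= (mu - nu2)(V) <= (mu - nu2)(W), because mu - nu2 is
     additive and nonnegative. *)
  rewrite /w/= -lerBrDl; apply: measure_pos_le => V VW.
  have [fd _] := baB bmu cnu2.1.
  apply: (@le_trans _ _ ((mu \- nu2) V)); first by rewrite /= lerD2r.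
  by apply: (fin_add_le fd _ VW) => U; rewrite subr_ge0.
(* The measure [w] dominates [nu1], which is used on [X], and [nu2], which is used on [Y]. *)
apply: le_trans (ca_part_ub Z cw wmu); rewrite (cw.1.1 X Y Z)// /w/=.
have := measure_pos_ge b12 X; have := measure_pos_ge0 b12 Y => /=; lra.
Qed.

Lemma ca_ca_part : ca A (ca_part mu).
Proof.
have fc := fin_add_ca_part; apply: ca_nonneg; last 2 first.
- exact: ca_part_ge0.
- move=> F Z b tF ZF hb; apply: ca_part_le => nu cnu numu.
  by apply: (ca_le_series cnu tF ZF _ hb) => k; exact: ca_part_ub.
apply: (ba_dominated fc bmu) => X.
by rewrite ca_part_ge0 ca_part_le_measure.
Qed.

(* [rho] below is the meet of [b] and [mu - ca_part mu]; adding it to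
   [ca_part mu] stays below [mu], so maximality forces [rho = 0]. *)
Lemma ca_part_rest_small (b : A -> R) X e : ca A b -> (forall Y, 0 <= b Y) ->
  0 < e -> exists Y, [/\ \val Y `<=` \val X,
    mu Y - ca_part mu Y <= e & b (algD X Y) <= e].
Proof.
move=> cb b0 e0; have [bb _] := cb; have cc := ca_ca_part.
pose p := mu \- ca_part mu.
have p0 Y : 0 <= p Y by rewrite subr_ge0 ca_part_le_measure.
have bbp : ba A (b \- p) by apply: baB => //; exact: baB cc.1.
pose rho := b \- measure_pos (b \- p).
have frho : finitely_additive rho := (baB bb (ba_measure_pos bbp)).1.
have crho : ca A rho.
  apply: (ca_dominated frho cb) => Y; apply/andP; split; last first.
    by rewrite lerBlDr lerDl; exact: measure_pos_ge0.
  rewrite subr_ge0; apply: measure_pos_le => W WY.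
  by rewrite lerBlDr (le_trans (fin_add_le bb.1 b0 WY))// lerDl.
have rho_le0 Y : rho Y <= 0.
  rewrite -(lerD2l (ca_part mu Y)) addr0.
  apply: (ca_part_ub (nu := ca_part mu \+ rho)) => [|W]; first exact: caD.
  by have := measure_pos_ge bbp W; rewrite /rho /p/=; lra.
(* If no [Y] works, then p(Y) + b(X \ Y) >= e, that is (b - p)(Y) <= b(X) - e, for all [Y] inside
   [X]. Hence rho(X) >= e > 0, against [rho_le0]. *)
apply: contrapT => none.
suff : measure_pos (b \- p) X <= b X - e by have := rho_le0 X; rewrite /rho/=; lra.
apply: measure_pos_le => Y YX; rewrite leNgt; apply/negP => ltY.
apply: none; exists Y.
have := b0 (algD X Y); have := p0 Y; move: ltY.
rewrite (fin_add_subset bb.1 YX) /p/= => ltY p0Y b0Y.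
by split=> //; lra.
Qed.

End CaPart.

(** * Weak absolute continuity *)

Lemma weakly_abs_continuous_dominated mu nu lambda :
  (forall X, 0 <= nu X <= mu X) -> weakly_abs_continuous mu lambda ->
  weakly_abs_continuous nu lambda.
Proof. by move=> numu wmu X /wmu mu0; have := numu X; rewrite mu0; lra. Qed.

Lemma weakly_abs_continuousB mu nu lambda :
  weakly_abs_continuous mu lambda -> weakly_abs_continuous nu lambda ->
  weakly_abs_continuous (mu \- nu) lambda.
Proof. by move=> wmu wnu X l0; rewrite /= wmu// wnu// subr0. Qed.

(** Subsets of a |lambda|-null set are |lambda|-null, so [mu] vanishes on all of them. *)
Lemma weakly_abs_continuous_pos mu lambda : ba A mu -> ba A lambda ->
  weakly_abs_continuous mu lambda ->
  weakly_abs_continuous (measure_pos mu) lambda.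
Proof.
move=> bmu bl wmu X l0; apply/eqP; rewrite eq_le measure_pos_ge0// andbT.
apply: measure_pos_le => Y YX; rewrite wmu//.
apply/eqP; rewrite eq_le variation_ge0// andbT -l0.
by apply: fin_add_le YX; [exact: (ba_variation bl).1|move=> ?; exact: variation_ge0].
Qed.

(** * Purity of the remainder and uniqueness *)

(** The variation of the difference is at most the sum of the two remainders. For each remainder,
    [ca_part_rest_small] with |nu| as [b] gives a separating set, and the intersection of the two
    serves the difference. *)
Lemma ca_orth_decomposition (P N : A -> R) : ba A P -> ba A N ->
  (forall X, 0 <= P X) -> (forall X, 0 <= N X) ->
  ca_orth A ((P \- ca_part P) \- (N \- ca_part N)).
Proof.
move=> bP bN P0 N0.
have bp := baB bP (ca_ca_part bP P0).1; have bn := baB bN (ca_ca_part bN N0).1.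
have bpn := baB bp bn; split=> // nu cnu; have [bnu _] := cnu.
apply/orthogonal_measuresP => // X e e0; have e20 : 0 < e / 2 by rewrite divr_gt0.
have nu0 Y : 0 <= measure_variation nu Y by exact: variation_ge0.
have p0 Y : 0 <= (P \- ca_part P) Y by rewrite subr_ge0 ca_part_le_measure.
have n0 Y : 0 <= (N \- ca_part N) Y by rewrite subr_ge0 ca_part_le_measure.
have [Y1 [Y1X pY1 nuY1]] := ca_part_rest_small bP P0 X (ca_variation cnu) nu0 e20.
have [Y2 [Y2X nY2 nuY2]] := ca_part_rest_small bN N0 X (ca_variation cnu) nu0 e20.
exists (algI Y1 Y2); split; first by move=> x [/Y1X].
  apply: le_trans (variation_le _ bpn (baD bp bn).1 _) _ => [Y|].
    by have := p0 Y; have := n0 Y; rewrite ler_norml /=; lra.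
  have := fin_add_le bp.1 p0 (@subIsetl _ _ _ : \val (algI Y1 Y2) `<=` \val Y1).
  have := fin_add_le bn.1 n0 (@subIsetr _ _ _ : \val (algI Y1 Y2) `<=` \val Y2).
  by rewrite /=; lra.
have := fin_add_setDI_le X Y1 Y2 (ba_variation bnu).1 nu0; lra.
Qed.

(** The difference d = p - q is orthogonal to [p] and to [q]. So some [W] inside [X] makes |p|(W),
    |q|(W) and |d|(X \ W) small, and |d(X)| is at most their sum. *)
Lemma ca_orth_diff_eq0 (p q : A -> R) :
  ca_orth A p -> ca_orth A q -> ca A (p \- q) -> p = q.
Proof.
move=> [bp op] [bq oq] cd; have [bd _] := cd.
have d0 Y : 0 <= measure_variation (p \- q) Y by exact: variation_ge0.
apply/funext => X; apply/eqP; rewrite -subr_eq0 -normr_le0.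
(* One quarter of [e] each for |p|(W), |q|(W), |d|(X \ Y) and |d|(X \ Z). *)
apply/ler_addgt0Pr => e e0; rewrite add0r; have e40 : 0 < e / 4 by rewrite divr_gt0.
have [Y [YX pY dY]] := (orthogonal_measuresP bp bd).1 (op _ cd) X _ e40.
have [Z [ZX qZ dZ]] := (orthogonal_measuresP bq bd).1 (oq _ cd) X _ e40.
pose W := algI Y Z.
have WX : \val W `<=` \val X by move=> x [/YX].
have dW := fin_add_setDI_le X Y Z (ba_variation bd).1 d0.
have := norm_le_variation (algD X W) bd.
have := norm_le_variation W bp; have := norm_le_variation W bq.
have := fin_add_le (ba_variation bp).1 (fun=> variation_ge0 _ bp)
  (@subIsetl _ _ _ : \val W `<=` \val Y).
have := fin_add_le (ba_variation bq).1 (fun=> variation_ge0 _ bq)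
  (@subIsetr _ _ _ : \val W `<=` \val Z).
have /= := fin_add_subset bd.1 WX; rewrite !ler_norml.
lra.
Qed.

End BoundedMeasures.

Theorem theorem3p16 (R : realType) (n : nat) (Omega : set 'rV[R]_n)
    (A : set (set 'rV[R]_n)) (hA : set_algebra Omega A)
    (lambda : A -> R) (hlambda : ba A lambda)
    (mu : A -> R) (hmu : ba_wac A lambda mu) :
  exists! p : (A -> R) * (A -> R),
    [/\ (ca A `&` ba_wac A lambda) p.1,
        (ca_orth A `&` ba_wac A lambda) p.2 &
        mu = p.1 \+ p.2].
Proof.
have [bmu wmu] := hmu.
(* Here [N] is the negative part of [mu], so mu = P - N with both terms nonnegative. *)
pose P := measure_pos mu; pose N := P \- mu.
have bP : ba A P := ba_measure_pos hA bmu; have bN : ba A N := baB bP bmu.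
have P0 X : 0 <= P X := measure_pos_ge0 hA bmu X.
have N0 X : 0 <= N X by rewrite subr_ge0 measure_pos_ge.
have wP : weakly_abs_continuous P lambda := weakly_abs_continuous_pos hA bmu hlambda wmu.
have wN : weakly_abs_continuous N lambda := weakly_abs_continuousB wP wmu.
have ca_part_wac m : ba A m -> (forall X, 0 <= m X) ->
    weakly_abs_continuous m lambda -> weakly_abs_continuous (ca_part m) lambda.
  move=> bm m0; apply: weakly_abs_continuous_dominated => X.
  by rewrite ca_part_ge0// ca_part_le_measure.
have cP := ca_ca_part hA bP P0; have cN := ca_ca_part hA bN N0.
have wcP := ca_part_wac _ bP P0 wP; have wcN := ca_part_wac _ bN N0 wN.
have orth := ca_orth_decomposition hA bP bN P0 N0.
exists (ca_part P \- ca_part N, (P \- ca_part P) \- (N \- ca_part N)); split.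
  split=> /=.
  - by split; [exact: caB|split; [exact: baB cP.1 cN.1|exact: weakly_abs_continuousB]].
  - split=> //; split; first exact: orth.1.
    by apply: weakly_abs_continuousB; exact: weakly_abs_continuousB.
  - by apply/funext => X; rewrite /N/=; ring.
move=> [c p] /= [[cc _] [op _] mu_eq].
(* Equating the two decompositions of [mu], the difference of the pure parts is a difference of
   sigma-measures, hence lies in [ca]. *)
have pE : (P \- ca_part P) \- (N \- ca_part N) = p.
  apply: (ca_orth_diff_eq0 hA) => //.
  rewrite (_ : _ \- _ = c \- (ca_part P \- ca_part N)).
    by apply: caB => //; exact: caB.
  apply/funext => X; have := congr1 (fun f : A -> R => f X) mu_eq.
  by rewrite /N/=; lra.
congr pair => //; apply/funext => X; have := congr1 (fun f : A -> R => f X) mu_eq.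
by rewrite -pE /N/=; lra.
Qed.
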